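(* Let $V\subseteq H\equiv H^*\subseteq V^*$ be a Gelfand triple (see context), let $T>0$ and $A:[0,T]\times V\to V^*$. Suppose there are a constant $C$ and measurable functions $\rho,\eta:V\to[0,+\infty)$, locally bounded in $V$ (i.e. bounded on bounded subsets of $V$), such that for all $t\in[0,T]$ and $v,v_1,v_2\in V$: (H1) (hemicontinuity) the map $s\mapsto\langle A(t,v_1+sv_2),v\rangle_V$ is continuous on $\mathbb{R}$; (H2) (local monotonicity) $\langle A(t,v_1)-A(t,v_2),v_1-v_2\rangle_V\le\left(C+\rho(v_1)+\eta(v_2)\right)\|v_1-v_2\|_H^2$. If the embedding $V\subseteq H$ is compact, then $A(t,\cdot):V\to V^*$ is pseudo-monotone for every $t\in[0,T]$.
   Context: Gelfand triple: $(H,\langle\cdot,\cdot\rangle_H)$ is a real separable Hilbert space identified with its dual $H^*$ by the Riesz isomorphism; $V$ is a real reflexive Banach space continuously and densely embedded into $H$; $\langle\cdot,\cdot\rangle_V$ denotes the duality pairing between $V^*$ and $V$, so that $\langle u,v\rangle_V=\langle u,v\rangle_H$ for $u\in H$, $v\in V$. Pseudo-monotone (sign convention of this paper): an operator $B:V\to V^*$ is called pseudo-monotone if, whenever $v_n\rightharpoonup v$ weakly in $V$ and $\liminf_{n\to\infty}\langle B(v_n),v_n-v\rangle_V\ge0$, one has for all $u\in V$ $$\langle B(v),v-u\rangle_V\ge\limsup_{n\to\infty}\langle B(v_n),v_n-u\rangle_V.$$ *)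

(* Defs.v *)
From HB Require Import structures.
From mathcomp Require Import all_boot all_order all_algebra.
From mathcomp Require Import all_classical all_reals all_analysis.

Set Implicit Arguments.
Unset Strict Implicit.
Unset Printing Implicit Defensive.

Import Order.TTheory GRing.Theory Num.Theory.
Import numFieldNormedType.Exports.

Local Open Scope classical_set_scope.
Local Open Scope ring_scope.

Section Dual.
Context {R : realType}.
Variable V : normedModType R.

Definition continuous_linear : {pred V -> R^o} :=
  fun f => `[< linear f /\ continuous f >].

Lemma continuous_linearP (f : V -> R^o) :
  reflect (linear f /\ continuous f) (f \in continuous_linear).
Proof. exact: asboolP. Qed.

Lemma continuous_linear_submod : submod_closed continuous_linear.
Proof.
split.
  apply/continuous_linearP; split=> [a u v|]; first by rewrite scaler0 addr0.
  exact: cst_continuous.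
move=> a f g /continuous_linearP[lf cf] /continuous_linearP[lg cg]; apply/continuous_linearP; split.
  move=> b u v; rewrite !fctE lf lg !scalerDr !scalerA (mulrC a b) -!addrA.
  by congr (_ + _); rewrite addrCA.
move=> x; apply: cvgD; last exact: cg.
by apply: cvgZl_tmp; exact: cf.
Qed.

HB.instance Definition _ := GRing.isSubmodClosed.Build R (V -> R^o)
  continuous_linear continuous_linear_submod.

(* The topological dual V^*, normed by the operator norm. *)
Record dual : Type := Dual {
  dual_fun :> V -> R^o ;
  dual_subproof : dual_fun \in continuous_linear }.

HB.instance Definition _ := [isSub for dual_fun].
HB.instance Definition _ := [Choice of dual by <:].
HB.instance Definition _ := [SubChoice_isSubLmodule of dual by <:].

Implicit Types f g : dual.

Lemma dual_linear f : linear (dual_fun f).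
Proof. by have /continuous_linearP[] := dual_subproof f. Qed.

HB.instance Definition _ f :=
  GRing.isLinear.Build R V R^o *:%R (dual_fun f) (dual_linear f).

Lemma dual_continuous f : continuous (dual_fun f).
Proof. by have /continuous_linearP[] := dual_subproof f. Qed.

Lemma dualP f g : (forall v, f v = g v) -> f = g.
Proof. by move=> fg; apply/val_inj/funext. Qed.

Definition dual_norm f : R := sup [set `|f v| | v in [set v : V | `|v| <= 1]].

Lemma dual_norm_has_sup f :
  has_sup [set `|f v| | v in [set v : V | `|v| <= 1]].
Proof.
split; first by exists `|f 0|, 0 => //=; rewrite normr0 ler01.
have /linear_boundedP := (linear_bounded_continuous (dual_fun f)).2
  (@dual_continuous f).
move=> /pinfty_ex_gt0[M M0 fM]; exists M => _ [v /= v1 <-].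
by rewrite (le_trans (fM v))// ger_pMr.
Qed.

Lemma dual_norm_ge f v : `|v| <= 1 -> `|f v| <= dual_norm f.
Proof. by move=> v1; apply: (sup_upper_bound (dual_norm_has_sup f)); exists v. Qed.

Lemma dual_norm_le f (M : R) :
  (forall v : V, `|v| <= 1 -> `|f v| <= M) -> dual_norm f <= M.
Proof.
move=> fM; apply: ge_sup; first by case: (dual_norm_has_sup f).
by move=> _ [v /= v1 <-]; exact: fM.
Qed.

Lemma dual_norm_ge0 f : 0 <= dual_norm f.
Proof. by rewrite (le_trans _ (@dual_norm_ge f 0 _))// normr0 ler01. Qed.

Lemma dual_norm_bound f v : `|f v| <= dual_norm f * `|v|.
Proof.
have [->|v0] := eqVneq v 0; first by rewrite linear0 !normr0 mulr0.
rewrite -ler_pdivrMr ?normr_gt0//.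
have := @dual_norm_ge f (`|v|^-1 *: v).
rewrite linearZ/= !normrZ normfV normr_id mulVf ?normr_eq0// => /(_ (lexx _)).
by rewrite mulrC.
Qed.

Let dual_normD f g : dual_norm (f + g) <= dual_norm f + dual_norm g.
Proof.
apply: dual_norm_le => v v1.
by rewrite (le_trans (ler_normD _ _))// lerD// dual_norm_ge.
Qed.

Let dual_normZ_le (a : R) f : dual_norm (a *: f) <= `|a| * dual_norm f.
Proof.
apply: dual_norm_le => v v1.
by rewrite [X in X <= _]normrM ler_wpM2l// dual_norm_ge.
Qed.

Let dual_normZ (a : R) f : dual_norm (a *: f) = `|a| * dual_norm f.
Proof.
apply/eqP; rewrite eq_le dual_normZ_le /=.
have [->|a0] := eqVneq a 0; first by rewrite normr0 mul0r dual_norm_ge0.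
rewrite -ler_pdivlMl ?normr_gt0// -normfV.
by rewrite -[X in dual_norm X <= _](scalerK a0) dual_normZ_le.
Qed.

Let dual_norm0_eq0 f : dual_norm f = 0 -> f = 0.
Proof.
move=> f0; apply: dualP => v; apply/eqP; rewrite -normr_le0.
by rewrite (le_trans (dual_norm_bound f v))// f0 mul0r.
Qed.

HB.instance Definition _ :=
  Lmodule_isNormed.Build R dual dual_normD dual_normZ dual_norm0_eq0.

Lemma dual_normE f :
  `|f| = sup [set `|f v| | v in [set v : V | `|v| <= 1]].
Proof. by []. Qed.

End Dual.

Section Notions.
Context {R : realType}.

Definition pairing (V : normedModType R) (f : dual V) (v : V) : R := f v.

Definition reflexive_space (V : normedModType R) : Prop :=
  forall phi : dual (dual V), exists v : V,
    forall f : dual V, pairing phi f = pairing f v.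

Definition separable_space (X : topologicalType) : Prop :=
  exists2 D : set X, countable D & dense D.

Definition weak_cvg (V : normedModType R) (w : V^nat) (v : V) : Prop :=
  forall f : dual V, pairing f (w n) @[n --> \oo] --> pairing f v.

Definition compact_map (V W : normedModType R) (g : V -> W) : Prop :=
  forall B : set V, bounded_set B -> precompact (g @` B).

Definition locally_bounded (V : normedModType R) (g : V -> R) : Prop :=
  forall B : set V, bounded_set B -> bounded_set (g @` B).

Definition borel_fun (V : normedModType R) (g : V -> R) : Prop :=
  measurable_fun [set: g_sigma_algebraType (@open V)]
    (g : g_sigma_algebraType (@open V) -> R).

(* The inclusions of V in H and of H = H^* in V^* are the maps j and i; the
   Riesz identification makes i u the functional v |-> <u, j v>_H. *)
Record gelfand_triple (H V : completeNormedModType R)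
    (ip : {dot H for idfun}) (j : {linear V -> H}) (i : H -> dual V) : Prop :=
  GelfandTriple {
    gelfand_norm_ip : forall x : H, `|x| ^+ 2 = ip x x ;
    gelfand_separable : separable_space H ;
    gelfand_reflexive : reflexive_space V ;
    gelfand_inj : injective j ;
    gelfand_continuous : continuous j ;
    gelfand_dense : dense (range j) ;
    gelfand_pairing : forall (u : H) (v : V), pairing (i u) v = ip u (j v) }.

(* The sign convention is the one adapted to dissipative operators: B is
   pseudo-monotone here iff - B is pseudo-monotone in the sense of Brezis. *)
Definition pseudo_monotone (V : normedModType R) (B : V -> dual V) : Prop :=
  forall (w : V^nat) (v : V), weak_cvg w v ->
    (0 <= limn_einf (fun n => (pairing (B (w n)) (w n - v))%:E))%E ->
    forall u : V,
      (limn_esup (fun n => (pairing (B (w n)) (w n - u))%:E)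
        <= (pairing (B v) (v - u))%:E)%E.

Definition hemicontinuous (V : normedModType R) (B : V -> dual V) : Prop :=
  forall v1 v2 v : V,
    continuous (fun s : R => pairing (B (v1 + s *: v2)) v).

End Notions.

(* Main.v *)
(* Along w_n -> v weakly, (w_n) is bounded in V and, by compactness of the
   embedding, w_n -> v strongly in H. Local monotonicity against
   z = v + s (u - v), s in [0, 1], then gives, with K uniform in n and s,
     <A w_n, w_n - z> <= K |w_n - z|_H^2 + <A z, w_n - z>.
   For s = 0 the right-hand side tends to 0, so the liminf hypothesis forces
   a_n = <A w_n, w_n - v> -> 0. For s > 0 the left-hand side is
   a_n + s <A w_n, v - u>, so dividing by s bounds the limsup of
   <A w_n, w_n - u> by s K |u - v|_H^2 + <A z, v - u>, and hemicontinuity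
   concludes as s -> 0+.
   Boundedness of (w_n) is Banach-Steinhaus on V^* (complete) combined with
   norming functionals, i.e. Hahn-Banach; the latter follows from Zorn's lemma
   since a pointwise minimal sublinear functional is linear. *)
Require Import Defs.
From HB Require Import structures.
From mathcomp Require Import all_boot all_order all_algebra.
From mathcomp Require Import all_classical all_reals all_analysis.
From mathcomp Require Import lra ring.

Set Implicit Arguments.
Unset Strict Implicit.
Unset Printing Implicit Defensive.

Import Order.TTheory GRing.Theory Num.Theory.
Import numFieldNormedType.Exports.

Local Open Scope classical_set_scope.
Local Open Scope ring_scope.

Section LocallyMonotone.
Context {R : realType}.

(** * Hahn-Banach theorem *)

(** Homogeneity is only asked as an inequality, the form that passes directly to infima; applying it
    to [a^-1] recovers equality in [sublinearZ]. *)
Definition sublinear (V : lmodType R) (q : V -> R) : Prop :=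
  (forall x y, q (x + y) <= q x + q y) /\
  (forall (a : R) x, 0 <= a -> q (a *: x) <= a * q x).

Section Sublinear.
Variables (V : lmodType R) (q : V -> R).
Hypothesis slq : sublinear q.

Lemma sublinear0 : q 0 = 0.
Proof.
case: slq => sub hom; apply/eqP; rewrite eq_le; apply/andP; split.
  by rewrite -[X in q X](scale0r 0) (le_trans (hom _ _ _))// mul0r.
by have := sub 0 0; rewrite addr0; lra.
Qed.

Lemma sublinearZ a x : 0 <= a -> q (a *: x) = a * q x.
Proof.
case: slq => sub hom; rewrite le_eqVlt => /predU1P[<-|a0].
  by rewrite scale0r mul0r sublinear0.
apply/eqP; rewrite eq_le (hom a x (ltW a0))/= -ler_pdivlMl//.
rewrite -[X in q X <= _](scalerK (lt0r_neq0 a0)).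
by rewrite hom// invr_ge0 ltW.
Qed.

Lemma sublinearN_ge x : - q (- x) <= q x.
Proof. by have := slq.1 x (- x); rewrite subrr sublinear0; lra. Qed.

End Sublinear.

(** Serves both the one-parameter infimum of [sublinear_lower] and the chains in Zorn's lemma. The
    minorant [m] and the index [i0] make each [inf] a genuine infimum; the index [k] may depend on
    the points, so no single [g i] has to be sublinear. *)
Lemma sublinear_inf (V : lmodType R) (I : Type) (i0 : I) (g : I -> V -> R)
    (m : V -> R) :
  (forall i x, m x <= g i x) ->
  (forall i j x y, exists k, g k (x + y) <= g i x + g j y) ->
  (forall i (a : R) x, 0 <= a -> exists k, g k (a *: x) <= a * g i x) ->
  let h x := inf (range (g ^~ x)) in
  sublinear h /\ forall i x, h x <= g i x.
Proof.
move=> mg gD gZ h.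
have hg i x : h x <= g i x.
  apply: ge_inf; last by exists i.
  by exists (m x) => _ [k _ <-].
have hge x c : (forall i, c <= g i x) -> c <= h x.
  move=> cg; apply: lb_le_inf; first by exists (g i0 x), i0.
  by move=> _ [k _ <-].
split=> //; split=> [x y|a x a0].
  rewrite -lerBlDr; apply: (hge _ _) => i; rewrite lerBlDr -lerBlDl.
  apply: (hge _ _) => k.
  have [l] := gD i k x y; rewrite lerBlDl; apply: le_trans; exact: hg.
move: a0; rewrite le_eqVlt => /predU1P[<-|a0].
  by have [k] := gZ i0 0 x (lexx _); rewrite !mul0r; apply: le_trans; exact: hg.
rewrite -ler_pdivrMl//; apply: (hge _ _) => i; rewrite ler_pdivrMl//.
have [k] := gZ i a x (ltW a0); apply: le_trans; exact: hg.
Qed.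

(** Take [h y] to be the infimum over [t >= 0] of [q (y + t *: x) - t * q x]: the value [t = 0]
    gives [h y <= q y], and [t = 1] at [y = - x] gives the last bound. *)
Lemma sublinear_lower (V : lmodType R) (q : V -> R) (x : V) : sublinear q ->
  exists h, [/\ sublinear h, forall y, h y <= q y & h (- x) <= - q x].
Proof.
move=> slq; pose g (t : {nonneg R}) y := q (y + t%:num *: x) - t%:num * q x.
have [] := @sublinear_inf V {nonneg R} 0%:nng g (fun y => - q (- y)).
- move=> t y; rewrite /g -sublinearZ// lerBrDr.
  have := slq.1 (- y) (y + t%:num *: x); rewrite addKr; lra.
- move=> s t y z; exists (s%:num + t%:num)%:nng; rewrite /g /= scalerDl addrACA.
  have := slq.1 (y + s%:num *: x) (z + t%:num *: x); lra.
- move=> t a y a0; exists ((NngNum a0)%:num * t%:num)%:nng.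
  by rewrite /g/= mulrBr mulrA lerB// -sublinearZ// scalerDr scalerA.
move=> slh hg; eexists; split; first exact: slh.
- by move=> y; apply: (le_trans (hg 0%:nng y));
    rewrite /g/= scale0r addr0 mul0r subr0.
- apply: (le_trans (hg 1%:nng _)).
  by rewrite /g/= scale1r addNr mul1r sublinear0// sub0r.
Qed.

(** Minimality against the [h] of [sublinear_lower] gives [q (- x) <= h (- x) <= - q x], so [q] is
    odd; an odd subadditive function is additive. *)
Lemma minimal_sublinear_linear (V : lmodType R) (q : V -> R) : sublinear q ->
  (forall h, sublinear h -> (forall x, h x <= q x) -> forall x, q x <= h x) ->
  linear (q : V -> R^o).
Proof.
move=> slq qmin.
have qN x : q (- x) = - q x.
  apply/eqP; rewrite eq_le; apply/andP; split.
    have [h [slh hq]] := sublinear_lower x slq.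
    exact/le_trans/qmin.
  by have := sublinearN_ge slq x; lra.
have qD x y : q (x + y) = q x + q y.
  apply/eqP; rewrite eq_le slq.1/=.
  by have := slq.1 (x + y) (- y); rewrite addrK qN; lra.
move=> a x y; rewrite qD; congr (_ + _).
have [a0|/ltW a0] := leP 0 a; first exact: sublinearZ.
by rewrite -[a]opprK scaleNr qN sublinearZ ?oppr_ge0// scaleNr.
Qed.

Lemma hahn_banach (V : lmodType R) (p : V -> R) : sublinear p ->
  exists f : V -> R^o, linear f /\ forall x, f x <= p x.
Proof.
move=> slp.
pose T := {q : V -> R | sublinear q /\ forall x, q x <= p x}.
pose mk q (slq : sublinear q) (qp : forall x, q x <= p x) : T :=
  exist _ q (conj slq qp).
pose below (s t : T) : bool := `[< forall x, sval t x <= sval s x >].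
have [] := @ZL_preorder T (mk p slp (fun=> lexx _)) below.
- by move=> s; apply/asboolP.
- move=> s r t /asboolP rs /asboolP st; apply/asboolP => x.
  exact: le_trans (st x) (rs x).
(* The order [below] is reversed, so a maximal element is a minimal functional. The empty chain is
   bounded by [p], a nonempty one by its pointwise infimum, where the smaller of two members serves
   as index for a sum. *)
- move=> A Atot; have [[s0 As0]|A0] := pselect (exists s, A s); last first.
    by exists (mk p slp (fun=> lexx _)) => s As; case: A0; exists s.
  pose g (s : {s | A s}) := sval (sval s).
  have [] := @sublinear_inf V {s | A s} (exist _ s0 As0) g (fun x => - p (- x)).
  + move=> [[q [slq qp]] As] x; rewrite /g/=.
    by rewrite (le_trans _ (sublinearN_ge slq x))// lerN2.
  + move=> [s As] [t At] x y; have [/asboolP st|/asboolP ts] := Atot _ _ As At.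
      exists (exist _ t At); rewrite /g/=.
      by apply: (le_trans ((svalP t).1.1 x y)); rewrite lerD2r.
    exists (exist _ s As); rewrite /g/=.
    by apply: (le_trans ((svalP s).1.1 x y)); rewrite lerD2l.
  + by move=> [s As] a x a0; exists (exist _ s As); exact: (svalP s).1.2.
  move=> slh hg; have hp x : inf (range (g ^~ x)) <= p x.
    exact: le_trans (hg (exist _ s0 As0) x) ((svalP s0).2 x).
  exists (mk _ slh hp) => s As; apply/asboolP => x.
  exact: (hg (exist _ s As)).
move=> [q [slq qp]] qmax; exists q; split=> //.
apply: minimal_sublinear_linear => // h slh hq x.
have hp y : h y <= p y by exact: le_trans (hq y) (qp y).
have /asboolP qh : below (mk h slh hp) (mk q slq qp) by exact/qmax/asboolP.
exact: qh.
Qed.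

Lemma bounded_linear_dual (V : normedModType R) (f : V -> R^o) (c : R) :
  0 <= c -> linear f -> (forall v, `|f v| <= c * `|v|) ->
  exists2 g : dual V, (forall v, g v = f v) & `|g| <= c.
Proof.
move=> c0 lf fc.
pose fL : {linear V -> R^o} := HB.pack f (GRing.isLinear.Build _ _ _ _ _ lf).
have cf : continuous fL.
  apply/linear_bounded_continuous/linear_boundedP.
  exists c; split=> [|M cM v]; first exact: num_real.
  by rewrite (le_trans (fc v))// ler_wpM2r// ltW.
have fd : f \in @continuous_linear R V by exact/continuous_linearP.
exists (Dual fd) => //; apply: dual_norm_le => v v1.
by rewrite (le_trans (fc v))// ler_piMr.
Qed.

(** Dominating [f] by the norm alone would not fix its value at [x]. The norm is first lowered to
    [h] with [h (- x) <= - |x|]; then [f <= h] forces [f x >= |x|]. *)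
Lemma norming_functional (V : normedModType R) (x : V) :
  exists2 f : dual V, `|f| <= 1 & f x = `|x|.
Proof.
have sln : sublinear (fun y : V => `|y|).
  by split=> [y z|a y a0]; [exact: ler_normD | rewrite normrZ ger0_norm].
have [h [slh hn hx]] := sublinear_lower x sln.
have [f [lf fh]] := hahn_banach slh.
have fx : - f x <= - `|x|.
  pose fL : {linear V -> R^o} := HB.pack f (GRing.isLinear.Build _ _ _ _ _ lf).
  by rewrite -(linearN fL) (le_trans (fh _)).
have fn y : `|f y| <= 1 * `|y|.
  pose fL : {linear V -> R^o} := HB.pack f (GRing.isLinear.Build _ _ _ _ _ lf).
  rewrite mul1r ler_norml (le_trans (fh y))// andbT lerNl.
  by rewrite -(linearN fL y) (le_trans (fh _))// (le_trans (hn _))// normrN.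
have [g gf g1] := bounded_linear_dual ler01 lf fn.
exists g => //; rewrite gf; apply/eqP; rewrite eq_le.
apply/andP; split; last by rewrite -lerN2.
by rewrite (le_trans (ler_norm _))// (le_trans (fn x))// mul1r.
Qed.

(** * Weakly convergent sequences *)

(** The limit is built pointwise in [R], and the Cauchy estimates survive the passage to the limit
    because they are closed conditions. Completeness allows Banach-Steinhaus to be applied on the
    dual. *)
Lemma dual_cauchy_cvg (V : normedModType R) (F : set_system (dual V)) :
  ProperFilter F -> cauchy F -> cvg F.
Proof.
move=> FF /cauchyP Fc.
have Fball (e : R) : 0 < e ->
    exists f0 : dual V,
      F [set f : dual V | forall v, `|f v - f0 v| <= e * `|v|].
  move=> e0; have [f0 Ff0] := Fc e e0; exists f0.
  apply: filterS Ff0 => f; rewrite -ball_normE /= => f0f v.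
  rewrite distrC (le_trans (dual_norm_bound (f0 - f) v))//.
  by rewrite ler_wpM2r// ltW.
have cvF v : cvg ((f : dual V) v @[f --> F]).
  apply: R_complete; apply/cauchyP => e e0.
  have e2 : 0 < e / (`|v| + 1) by rewrite divr_gt0// ltr_wpDl.
  have [f0 Ff0] := Fball _ e2; exists (f0 v).
  suff : F [set f : dual V | ball (f0 v) e (f v)] by [].
  apply: filterS Ff0 => f /(_ v) ff0.
  rewrite -ball_normE /= distrC (le_lt_trans ff0)//.
  rewrite mulrAC ltr_pdivrMr ?ltr_wpDl//.
  by rewrite ltr_pM2l// ltrDl.
pose g v : R^o := lim ((f : dual V) v @[f --> F]).
have Fg (f0 : dual V) (e : R) :
    F [set f : dual V | forall v, `|f v - f0 v| <= e * `|v|] ->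
    forall v, `|g v - f0 v| <= e * `|v|.
  move=> Ff0 v.
  have gv : `|(f : dual V) v - f0 v| @[f --> F] --> `|g v - f0 v|.
    by apply: cvg_norm; apply: cvgB; [exact: cvF|exact: cvg_cst].
  apply: (closed_cvg (fun x => x <= _) (@closed_le _ _) _ _ gv).
  by apply: filterS Ff0 => f; exact.
have lg : linear g.
  move=> a u v; pose ev := fun f : dual V => f (a *: u + v).
  apply: (@cvg_unique _ (@Rhausdorff R) (ev @ F) _ _ _ (cvF _)).
  rewrite (_ : ev = fun f => a *: f u + f v); last first.
    by apply/funext => f; rewrite /ev linearP.
  by apply: cvgD; [apply: cvgZl_tmp|]; exact: cvF.
have [f1 /Fg gf1] := Fball 1 ltr01.
have gb v : `|g v| <= (`|f1| + 1) * `|v|.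
  rewrite -[g v](subrK (f1 v)) (le_trans (ler_normD _ _))// mulrDl addrC.
  by rewrite lerD// dual_norm_bound.
have [G gG _] := bounded_linear_dual (addr_ge0 (normr_ge0 _) ler01) lg gb.
apply/cvg_ex; exists G; apply/fcvgrPdist_lt => e e0.
have e3 : 0 < e / 3 by rewrite divr_gt0.
have [f0 Ff0] := Fball _ e3; have gf0 := Fg _ _ Ff0.
apply: filterS Ff0 => f ff0.
(* A supremum only yields a non-strict bound, while the goal is strict: thirds of [e] leave the
   needed slack. *)
apply: (@le_lt_trans _ _ (e / 3 + e / 3)); last by lra.
apply: dual_norm_le => v v1.
rewrite (_ : (G - f) v = (g v - f0 v) - (f v - f0 v)); last first.
  by rewrite opprB addrA subrK -gG.
rewrite (le_trans (ler_normB _ _))// lerD//.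
  by rewrite (le_trans (gf0 v))// ler_piMr// ltW.
by rewrite (le_trans (ff0 v))// ler_piMr// ltW.
Qed.

HB.instance Definition _ (V : normedModType R) :=
  Uniform_isComplete.Build (dual V) (@dual_cauchy_cvg V).

Lemma weak_cvg_bounded (V : normedModType R) (w : V^nat) (v : V) :
  weak_cvg w v -> bounded_set (range w).
Proof.
move=> wv.
pose E := range (fun n (f : dual V) => f (w n) : R^o).
have Elin f : E f -> bounded_fun_norm f /\ linear f.
  move=> [n _ <-]; split=> [r|a f1 f2 //]; exists (r * `|w n|) => g gr.
  by rewrite (le_trans (dual_norm_bound g _))// ler_wpM2r.
have Ebnd : pointwise_bounded E.
  move=> f; have /cvg_seq_bounded[M [_ fM]] : cvgn (fun n => f (w n) : R).
    by apply/cvg_ex; exists (f v); exact: wv.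
  exists (M + 1) => _ [n _ <-].
  exact: (fM (M + 1) (ltr_pwDr ltr01 (lexx M)) n).
have [M wM] := Banach_Steinhauss Elin Ebnd 1.
exists M; split=> [|B /ltW MB _ [n _ <-]]; first exact: num_real.
rewrite /= (le_trans _ MB)//.
have [f f1 <-] := norming_functional (w n).
rewrite (le_trans (ler_norm _))//.
exact: (wM _ (ex_intro2 _ _ n Logic.I erefl) f f1).
Qed.

(** By polarization, [ip u] is a polynomial in norms, which are continuous. *)
Lemma dot_continuous (H : normedModType R) (ip : {dot H for idfun}) :
  (forall x : H, `|x| ^+ 2 = ip x x) ->
  forall u x, ip u y @[y --> x] --> ip u x.
Proof.
move=> normE u x.
have ipE y : ip u y = (`|u + y| ^+ 2 - `|u - y| ^+ 2) / 4.
  have ipC : ip y u = ip u y by rewrite [LHS]hermC expr0 mul1r.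
  rewrite !normE !(linearDl, linearDr, linearNl, linearNr)/= ipC.
  by field.
move=> A; rewrite ipE => uxA.
suff : \forall y \near x, A ((`|u + y| ^+ 2 - `|u - y| ^+ 2) / 4).
  by apply: filterS => y; rewrite /= ipE.
move: A uxA; apply: cvgM; last exact: cvg_cst.
by apply: cvgB; apply: cvgM; apply: cvg_norm;
  (apply: cvgB || apply: cvgD); (exact: cvg_cst || exact: cvg_id).
Qed.

Lemma gelfand_compact_cvg (H V : completeNormedModType R)
    (ip : {dot H for idfun}) (j : {linear V -> H}) (i : H -> dual V)
    (w : V^nat) (v : V) :
  gelfand_triple ip j i -> compact_map j -> weak_cvg w v ->
  j (w n) @[n --> \oo] --> j v.
Proof.
move=> HV jK wv; have [normE _ _ _ _ _ iE] := HV.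
have /jK := weak_cvg_bounded wv; rewrite precompactE => cK.
apply/cvgrPdist_lt => e e0; apply: contrapT => Nnear.
(* Restricting the filter at infinity to [far] replaces the extraction of a subsequence staying at
   distance [e] from [j v]. Compactness gives it a cluster point [p], which must be both [j v] and
   at distance at least [e] from it. *)
pose far := [set n | e <= `|j v - j (w n)|].
have farP : ProperFilter (within far \oo).
  split; last exact: within_filter.
  rewrite /within /= => Nfar; apply: Nnear.
  by apply: filterS Nfar => n /= nfar; rewrite ltNge; apply/negP.
pose G := (j \o w) @ within far \oo.
have GK : G (closure (j @` range w)).
  by apply: nearW => n _; apply: subset_closure; exists (w n) => //; exists n.
have [p [_]] := cK G _ GK; rewrite cluster_cvgE => -[G' G'P [G'p GG']].
have ep : e <= `|j v - p|.
  have dp : `|j v - x| @[x --> G'] --> `|j v - p|.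
    by apply: cvg_norm; apply: cvgB; [exact: cvg_cst|exact: G'p].
  apply: (closed_cvg (fun x => e <= x) (@closed_ge _ _) _ _ dp).
  by apply: GG'; exact: withinT.
(* Weak convergence tested on [i u] identifies the cluster point; the choice [u = j v - p] then
   gives [p = j v]. *)
have ipp u : ip u p = ip u (j v).
  apply: (@cvg_unique _ (@Rhausdorff R) (ip u x @[x --> G'])).
    by move=> A /(dot_continuous normE)/G'p.
  move=> A; rewrite -iE => /(wv (i u)) wA.
  have {}wA : \forall n \near \oo, A (pairing (i u) (w n)) by [].
  apply: (GG' [set x | A (ip u x)]).
  suff : \forall n \near \oo, far n -> A (ip u (j (w n))) by [].
  by apply: filterS wA => n /=; rewrite iE.
have : ip (j v - p) (j v - p) = 0 by rewrite linearBr/= ipp subrr.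
move/eqP; rewrite -normE expf_eq0 /= normr_eq0 => /eqP jvp.
by move: ep; rewrite jvp normr0 leNgt e0.
Qed.

(** * Local monotonicity and pseudo-monotonicity *)

Lemma limn_esup_le_near (u : (\bar R)^nat) (l : \bar R) :
  (\forall n \near \oo, u n <= l)%E -> (limn_esup u <= l)%E.
Proof.
move=> ul; apply: (@le_trans _ _ (ereal_sup (u @` [set n | u n <= l]%E))).
  by apply: ereal_inf_lbound; exists [set n | u n <= l]%E.
by apply: ge_ereal_sup => _ [n /= unl <-].
Qed.

Lemma lt_limn_einf_near (u : (\bar R)^nat) (l : \bar R) :
  (l < limn_einf u)%E -> (\forall n \near \oo, l < u n)%E.
Proof.
rewrite [limn_einf u]limf_einfE => /ereal_sup_gt[_ [A Aoo <-] lA].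
apply: filterS Aoo => n An; apply: lt_le_trans lA _.
by apply: ereal_inf_lbound; exists n.
Qed.

Lemma locally_bounded_le (V : normedModType R) (g : V -> R) (B : set V) :
  locally_bounded g -> bounded_set B -> exists M, forall x, B x -> g x <= M.
Proof.
move=> gb /gb[M [_ gM]]; exists (M + 1) => x Bx.
rewrite (le_trans (ler_norm _))//.
by apply: (gM (M + 1)); [rewrite ltrDl|exists x].
Qed.

Lemma pairingB (V : normedModType R) (f : dual V) (u v : V) :
  pairing f (u - v) = pairing f u - pairing f v.
Proof. exact: linearB. Qed.

Lemma locally_monotone_pseudo_monotone (H V : normedModType R)
    (j : {linear V -> H}) (B : V -> dual V) (C : R) (rho eta : V -> R) :
  locally_bounded rho -> locally_bounded eta -> hemicontinuous B ->
  (forall v1 v2 : V, pairing (B v1 - B v2) (v1 - v2)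
     <= (C + rho v1 + eta v2) * `|j (v1 - v2)| ^+ 2) ->
  (forall (w : V^nat) v, weak_cvg w v -> j (w n) @[n --> \oo] --> j v) ->
  pseudo_monotone B.
Proof.
move=> rhob etab hemiB monB jcvg w v wv ainf u.
have [Mr rhoM] := locally_bounded_le rhob (weak_cvg_bounded wv).
pose z s := v + s *: (u - v).
(* The segment from [v] to [u] is bounded in [V], so the constant [K] below depends on neither [s]
   nor [n]. *)
have [Me etaM] : exists M, forall s, 0 <= s <= 1 -> eta (z s) <= M.
  have [|M etaM] := @locally_bounded_le _ eta (z @` [set s | 0 <= s <= 1]) etab.
    exists (`|v| + `|u - v|); split=> [|M /ltW MB _ [s /andP[s0 s1] <-]].
      exact: num_real.
    rewrite /= (le_trans _ MB)// (le_trans (ler_normD _ _))// lerD2l normrZ.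
    by rewrite ger0_norm// ler_piMl.
  by exists M => s s01; apply: etaM; exists s.
pose K := C + Mr + Me.
pose a n := pairing (B (w n)) (w n - v).
have mon s n : 0 <= s <= 1 -> pairing (B (w n)) (w n - z s) <=
    K * `|j (w n) - j (z s)| ^+ 2 + pairing (B (z s)) (w n - z s).
  move=> s01; rewrite -lerBlDr -linearB.
  apply: (le_trans (monB _ _)); apply: ler_wpM2r; first exact: exprn_ge0.
  by rewrite !lerD// ?etaM// rhoM//; exists n.
have bnd_cvg s : K * `|j (w n) - j (z s)| ^+ 2 + pairing (B (z s)) (w n - z s)
    @[n --> \oo] --> K * `|j v - j (z s)| ^+ 2 + pairing (B (z s)) (v - z s).
  have jc : `|j (w n) - j (z s)| @[n --> \oo] --> `|j v - j (z s)|.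
    by apply: cvg_norm; apply: cvgB; [exact: jcvg|exact: cvg_cst].
  apply: cvgD; first by apply: cvgM; [exact: cvg_cst|exact: cvgM].
  rewrite pairingB; under eq_fun do rewrite pairingB.
  by apply: cvgB; [exact: wv|exact: cvg_cst].
(* The liminf hypothesis bounds [a n] from below, and [mon] at [s = 0] from above. *)
have a_cvg : a n @[n --> \oo] --> 0.
  have z0 : z 0 = v by rewrite /z scale0r addr0.
  have b0 : K * `|j (w n) - j v| ^+ 2 + pairing (B v) (w n - v)
      @[n --> \oo] --> 0.
    have := bnd_cvg 0; rewrite z0 !subrr normr0 expr0n mulr0 add0r.
    by rewrite [pairing _ 0]linear0.
  have aN (e : R) : 0 < e -> \forall n \near \oo, - e < a n.
    move=> e0; have : (- e%:E < limn_einf (fun n => (a n)%:E))%E.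
      by apply: lt_le_trans ainf; rewrite oppe_lt0 lte_fin.
    by move/lt_limn_einf_near; apply: filterS => n; rewrite -EFinN lte_fin.
  apply/cvgrPdist_le => e e0.
  have {}aN := aN e e0; have bN : \forall n \near \oo,
      K * `|j (w n) - j v| ^+ 2 + pairing (B v) (w n - v) <= e.
    exact: cvgr_le b0 _ e0.
  near=> n; rewrite sub0r normrN ler_norml; apply/andP; split.
    by apply: ltW; near: n.
  have := mon 0 n; rewrite lexx ler01 z0 => /(_ isT)/le_trans; apply.
  by near: n.
(* Since [v - z s = s *: (v - u)], the limit of the bound in [mon] is quadratic in [s] in its first
   term and carries a factor [s] in its second; [L s] is that limit divided by [s]. *)
pose L s := s * K * `|j (u - v)| ^+ 2 + pairing (B (z s)) (v - u).
have esup_le s : 0 < s -> s <= 1 ->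
    (limn_esup (fun n => (pairing (B (w n)) (w n - u))%:E) <= (L s)%:E)%E.
  move=> s0 s1.
  pose b n := K * `|j (w n) - j (z s)| ^+ 2 + pairing (B (z s)) (w n - z s).
  have bL : a n + s^-1 * (b n - a n) @[n --> \oo] --> L s.
    rewrite (_ : L s = 0 + s^-1 *
      (K * `|j v - j (z s)| ^+ 2 + pairing (B (z s)) (v - z s) - 0));
      last first.
      rewrite subr0 add0r -linearB (_ : v - z s = s *: (v - u)); last first.
        by rewrite /z opprD addNKr -scalerN opprB.
      rewrite linearZ/= normrZ (gtr0_norm s0) [pairing _ (s *: _)]linearZ/=.
      rewrite /L -(opprB v u) linearN normrN /pairing.
      rewrite -[_ *: _]/(s * _).
      field; exact: lt0r_neq0.
    apply: cvgD => //; apply: cvgM; first exact: cvg_cst.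
    by apply: cvgB => //; exact: bnd_cvg.
  (* Splitting [w n - z s] as [(w n - v) + s *: (v - u)] turns [mon] into a bound on the pairing of
     [B (w n)] with [v - u], to which [a n] is added. *)
  have wb n : pairing (B (w n)) (w n - u) <= a n + s^-1 * (b n - a n).
    rewrite -(subrKA v) [pairing _ (_ + _)]linearD/= lerD2l ler_pdivlMl//.
    rewrite lerBrDl; apply: le_trans (mon s n _); last by rewrite ltW.
    have -> : w n - z s = (w n - v) + s *: (v - u).
      by rewrite /z opprD addrA -scalerN opprB.
    by rewrite (addrC (w n - v)) /a /pairing linearP addrC.
  apply/lee_addgt0Pr => e e0; apply: limn_esup_le_near.
  have : \forall n \near \oo, a n + s^-1 * (b n - a n) <= L s + e.
    by apply: cvgr_le bL _ _; rewrite ltrDl.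
  by apply: filterS => n bLn; rewrite -EFinD lee_fin (le_trans (wb n)).
(* Only the limit from the right matters, since [esup_le] requires [0 < s]; hemicontinuity along
   [u - v] handles the second term. *)
have L_cvg : L s @[s --> 0^'+] --> pairing (B v) (v - u).
  apply: cvg_at_right_filter.
  rewrite -[X in _ --> X]add0r.
  rewrite -[X in _ --> X + _](mul0r (K * `|j (u - v)| ^+ 2)).
  under eq_fun do rewrite /L -mulrA.
  apply: cvgD; first by apply: cvgM; [exact: cvg_id|exact: cvg_cst].
  have := hemiB v (u - v) (v - u) 0; rewrite /continuous_at scale0r addr0.
  exact.
apply/lee_addgt0Pr => e e0.
have Le : \forall s \near 0^'+, L s <= pairing (B v) (v - u) + e.
  by apply: cvgr_le L_cvg _ _; rewrite ltrDl.
near (0 : R)^'+ => s.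
apply: (@le_trans _ _ (L s)%:E).
  by apply: esup_le; near: s; [exact: nbhs_right_gt|exact: nbhs_right_le].
by rewrite -EFinD lee_fin; near: s.
Unshelve. all: by end_near.
Qed.

End LocallyMonotone.

Theorem lemma2p2 (R : realType) (H V : completeNormedModType R)
  (ip : {dot H for idfun}) (j : {linear V -> H}) (i : H -> dual V)
  (HV : gelfand_triple ip j i)
  (T : R) (T_gt0 : 0 < T) (A : R -> V -> dual V)
  (C : R) (rho eta : V -> R)
  (rho_ge0 : forall v, 0 <= rho v) (eta_ge0 : forall v, 0 <= eta v)
  (rho_meas : borel_fun rho) (eta_meas : borel_fun eta)
  (rho_bnd : locally_bounded rho) (eta_bnd : locally_bounded eta)
  (H1 : forall t, t \in `[0, T] -> hemicontinuous (A t))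
  (H2 : forall t, t \in `[0, T] -> forall v1 v2 : V,
    pairing (A t v1 - A t v2) (v1 - v2)
      <= (C + rho v1 + eta v2) * `|j (v1 - v2)| ^+ 2)
  (j_compact : compact_map j) :
  forall t, t \in `[0, T] -> pseudo_monotone (A t).
Proof.
move=> t tT.
have jcvg w v := @gelfand_compact_cvg R H V ip j i w v HV j_compact.
exact: (locally_monotone_pseudo_monotone rho_bnd eta_bnd
  (H1 t tT) (H2 t tT) jcvg).
Qed.
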